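(* Let $(X_n)_{n\ge0}$ be the Kendall random walk with step distribution $\nu\in\mathcal P_s$, $\nu(\{0\})=0$, let $\tau_a^+=\min\{n\ge1:X_n>a\}$, and let $t>a>0$ with $\nu(\{a\})=\nu(\{t\})=0$ and $G(t)\ne2G(a)$. Write $D=2G(a)-G(t)$ and $\Phi^a_n(t)=\mathbb P(X_{\tau_a^+}\le t,\ \tau_a^+=n)$. Then $\Phi^a_1(t)=F(t)-F(a)$, and for $n\ge2$ $$\begin{aligned}\Phi^a_n(t)={}&\Big(\frac{G(t)}2\Big)^{n-1}\Big[\frac{2G(a)H(a)(G(t)-G(a))}{D^2}-\frac{G(a)^2}{D}+\frac{(n-1)C_1H(t)}{G(t)}-\frac{G(a)H(t)}{D}\Big(C_3-\frac{C_2G(t)}{D}\Big)+II(1,a,t)\Big]\\ &+G(a)^{n-1}\Big[\frac{(nH(a)+G(a))(G(t)-G(a))}{D}-\frac{G(a)G(t)H(a)}{D^2}+\frac{G(a)H(t)C_2n}{D}\\&\qquad+\frac{G(t)H(t)}{D}\Big(\frac{C_3-C_2}2-\frac{G(a)C_2}{D}\Big)+\frac{H(t)(C_3-C_2)}2\Big],\end{aligned}$$ where $II(1,a,t)=\frac12(H(a)+H(t)+G(a)+G(t))$, $I(1,a,t)=\tfrac12G(t)+\tfrac12H(a)\Psi(\tfrac at)+\tfrac12G(a)$, $C_1=I(1,a,t)-\frac{G(a)}{D}\big[G(a)+H(a)\Psi(\frac at)(1-\frac{G(t)}{D})\big]$, $C_2=\frac{H(a)\Psi(\frac at)}{D}$,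 $C_3=\frac{H(a)\Psi(\frac at)+G(a)}{D}-\frac{2H(a)G(a)\Psi(\frac at)}{D^2}$.
   Context: Fix $\alpha>0$. $\mathcal P_s$ is the set of symmetric Borel probability measures on $\mathbb R$. For $x\in\mathbb R$, $\widetilde\delta_x=\frac12(\delta_x+\delta_{-x})$. For a probability measure $\lambda=\mathcal L(X)$ and $c>0$, $T_c\lambda=\mathcal L(cX)$, and $T_0\lambda=\delta_0$. $\widetilde\pi_{2\alpha}$ is the symmetric Pareto probability measure with density $\alpha|y|^{-2\alpha-1}\mathbf 1_{\{|y|\ge1\}}$. The Kendall convolution $\vartriangle_\alpha$ on $\mathcal P_s$ is defined by $\widetilde\delta_x\vartriangle_\alpha\widetilde\delta_y=T_M\big(\varrho^\alpha\widetilde\pi_{2\alpha}+(1-\varrho^\alpha)\widetilde\delta_1\big)$ where $M=\max(|x|,|y|)$, $m=\min(|x|,|y|)$, $\varrho=m/M$ (and $\varrho=0$ if $M=0$), extended by $(\nu_1\vartriangle_\alpha\nu_2)(A)=\int\int(\widetilde\delta_x\vartriangle_\alpha\widetilde\delta_y)(A)\,\nu_1(dx)\nu_2(dy)$. For $x\in\mathbb R$ and $\mu\in\mathcal P_s$ we write $\delta_x\vartriangle_\alpha\mu:=\widetilde\delta_x\vartriangle_\alpha\mu$. $\Psi(t)=(1-|t|^\alpha)_+$. For the measure $\nu$: $F(t)=\nu((-\infty,t])$, $G(t)=\int_{\mathbb R}\Psi(x/t)\,\nu(dx)$ for $t\neq0$, and for $t>0$, $H(t)=2F(t)-1-G(t)=t^{-\alpha}\int_{[-t,t]}|x|^\alpha\nu(dx)$.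 The Kendall random walk with step distribution $\nu$ is the Markov chain $(X_n)_{n\ge0}$ with $X_0=0$ and transition kernel $\mathbb P(X_{k+1}\in A\mid X_k=x)=(\delta_x\vartriangle_\alpha\nu)(A)$. *)

(* Defs.v *)
From HB Require Import structures.
From mathcomp Require Import all_boot all_order all_algebra.
From mathcomp Require Import all_classical all_reals all_analysis.
Set Implicit Arguments. Unset Strict Implicit. Unset Printing Implicit Defensive.
Import Order.TTheory GRing.Theory Num.Theory.
Import numFieldNormedType.Exports.
Local Open Scope classical_set_scope.
Local Open Scope ring_scope.

Section Kendall.
Variables (R : realType) (alpha : R).

Definition symmetric_measure (nu : probability R R) :=
  forall A : set R, measurable A -> nu A = nu [set - x | x in A].

Definition Psi (t : R) : R := Num.max 0 (1 - `|t| `^ alpha).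

Definition kF (nu : probability R R) (t : R) : R := fine (nu [set x : R | x <= t]).
Definition kG (nu : probability R R) (t : R) : R :=
  Rintegral nu setT (fun x => Psi (x / t)).
Definition kH (nu : probability R R) (t : R) : R := 2 * kF nu t - 1 - kG nu t.

(* integral of a nonnegative f against delta~_x (Kendall conv) delta~_z:
   T_M (rho^alpha pi~_{2 alpha} + (1 - rho^alpha) delta~_1),
   and T_0 (.) = delta_0. *)
Definition kendall_pair_int (f : R -> \bar R) (x z : R) : \bar R :=
  let M : R := Num.max `|x| `|z| in
  let m : R := Num.min `|x| `|z| in
  let rho : R := if M == 0 then 0 else m / M in
  if M == 0 then f 0 else
  ((rho `^ alpha)%R%:E *
     (\int[lebesgue_measure]_(u in [set u : R | (1 <= `|u|)%R])
        (f (M * u)%R * (alpha * `|u| `^ (- (2 * alpha + 1)))%R%:E))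
   + ((1 - rho `^ alpha) / 2)%R%:E * (f M + f (- M)%R))%E.

(* integral of f against the transition measure delta_x (Kendall conv) nu *)
Definition kendall_kernel_int (nu : probability R R) (f : R -> \bar R) (x : R)
  : \bar R := (\int[nu]_z kendall_pair_int f x z)%E.

(* P(X_1 in A_1, ..., X_k in A_k | X_0 = x) for the chain with kernel
   A |-> (delta_x (Kendall conv) nu)(A) *)
Fixpoint kendall_path_prob (nu : probability R R) (As : seq (set R)) (x : R)
  : \bar R :=
  match As with
  | [::] => 1%E
  | B :: As' =>
      kendall_kernel_int nu (fun y => ((\1_B y)%:E * kendall_path_prob nu As' y)%E) x
  end.

(* (X_n) is the Kendall random walk with step distribution nu, X_0 = 0:
   its finite dimensional distributions are those of the Markov chain
   started at 0 with the Kendall transition kernel. *)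
Definition is_kendall_random_walk (d : measure_display) (Omega : measurableType d)
  (P : probability Omega R) (nu : probability R R) (X : nat -> Omega -> R) :=
  (forall n, measurable_fun setT (X n)) /\
  (forall w, X 0%N w = 0) /\
  (forall As : seq (set R), (forall B, B \in As -> measurable B) ->
     P [set w | forall i, (i < size As)%N -> nth setT As i (X i.+1 w)]
     = kendall_path_prob nu As 0).

Definition first_passage_eq (Omega : Type) (X : nat -> Omega -> R) (a : R)
  (n : nat) (w : Omega) :=
  (1 <= n)%N /\ a < X n w /\ (forall k, (1 <= k < n)%N -> X k w <= a).

End Kendall.

(* Main.v *)
Require Import Defs.
From HB Require Import structures.
From mathcomp Require Import all_boot all_order all_algebra.
From mathcomp Require Import all_classical all_reals all_analysis measurable_realfun.
From mathcomp Require Import ring lra.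
Import Order.TTheory GRing.Theory Num.Theory.
Import numFieldNormedType.Exports.
Local Open Scope classical_set_scope.
Local Open Scope ring_scope.
Set Implicit Arguments. Unset Strict Implicit. Unset Printing Implicit Defensive.

(** Write [u_s] for the indicator of [[-s, s]] and [v_s = Psi (. / s)].  The Kendall
    kernel multiplies [v_s] by [G s] (Williamson transform) and maps [u_s] to
    [G s u_s + H s v_s].  Killing the walk above [a] replaces an even function [f]
    by the even part of [1_(]-oo, a]) f], that is [(1 + u_a) f / 2], and [u_a v_t]
    is a combination of [u_a] and [v_a].  Hence the value functions
    [x |-> P_x (X_1, ..., X_(n-1) <= a < X_n <= t)] stay in the span of
    [u_a, v_a, u_t, v_t], with coefficients given by a linear recursion that is
    solved explicitly and evaluated at [x = 0]. *)

(** * The coefficient recursion and its closed form *)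

(* With [g = G a], [h = H a], [q = G t / 2], [k = H t / 2], [p = Psi (a / t)], the
   value function after [m + 1] steps is
   [g c u_a + d v_a + q^(m+1) u_t + (m+1) k q^m v_t] with [(c, d)] as below;
   the factor [g] is split off so that the closed form never divides by [g],
   which may vanish. *)
Fixpoint passage_coef (R : realFieldType) (g h q k p : R) (m : nat) : R * R :=
  if m is m'.+1 then
    let cd := passage_coef g h q k p m' in
    let l := m%:R * k * q ^+ m' in
    let c := g * cd.1 + (q ^+ m + l * p) / 2 in
    (c, h * c + g * (cd.2 + l * (1 - p) / 2))
  else (- 1 / 2, - h / 2).

(** Undetermined coefficients: the forcing is [q ^+ m] times an affine function of [m], so a
    particular solution has the same form when [g != q]. The homogeneous part [A * g ^+ m] of the
    first component drives the second at its own rate [g]; this resonance produces the term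
    [h * A * m%:R]. *)
Lemma passage_coefE (R : realFieldType) (g h q k p : R) (m : nat) :
  g - q != 0 ->
  let C := - (p * k) / (2 * (g - q)) in
  let B := (C * q - (q + p * k) / 2) / (g - q) in
  let A := - 1 / 2 - B in
  let S := - (h * C * q + g * (1 - p) * k / 2) / (g - q) in
  let T := - (h * (B + C) * q + g * (1 - p) * k / 2 - S * q) / (g - q) in
  passage_coef g h q k p m =
  (A * g ^+ m + (B + C * m%:R) * q ^+ m,
   (- h / 2 - T + h * A * m%:R) * g ^+ m + (T + S * m%:R) * q ^+ m).
Proof.
move=> gq C B A S T.
elim: m => [|m IH] /=; first by congr pair; rewrite !expr0 /A; field.
rewrite IH /= -natr1 !exprS.
by congr pair; rewrite /T /S /A /B /C; field.
Qed.

(** The left side is the value function at 0, where [u_a], [v_a], [u_t], [v_t] all equal 1. The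
    index [m.+1] belongs to passage at time [n = m.+2]. *)
Lemma passage_coef_sum (R : realFieldType) (g h p r s : R) (m : nat) :
  r != 0 -> r != 2 * g ->
  let D := 2 * g - r in
  let II := (h + s + g + r) / 2 in
  let I := r / 2 + h * p / 2 + g / 2 in
  let C1 := I - g / D * (g + h * p * (1 - r / D)) in
  let C2 := h * p / D in
  let C3 := (h * p + g) / D - 2 * h * g * p / D ^+ 2 in
  let cd := passage_coef g h (r / 2) (s / 2) p m.+1 in
  g * cd.1 + cd.2 + (r / 2) ^+ m.+2 + m.+2%:R * (s / 2) * (r / 2) ^+ m.+1 =
  (r / 2) ^+ m.+1 *
    (2 * g * h * (r - g) / D ^+ 2 - g ^+ 2 / D + m.+1%:R * C1 * s / r
     - g * s / D * (C3 - C2 * r / D) + II)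
  + g ^+ m.+1 *
    ((m.+2%:R * h + g) * (r - g) / D - g * r * h / D ^+ 2
     + g * s * C2 * m.+2%:R / D + r * s / D * ((C3 - C2) / 2 - g * C2 / D)
     + s * (C3 - C2) / 2).
Proof.
move=> r0 rg D II I C1 C2 C3 cd.
have D0 : 2 * g - r != 0 by rewrite subr_eq0 eq_sym.
have gq : g - r / 2 != 0.
  by apply: contraNneq D0 => e; apply/eqP; lra.
rewrite /cd passage_coefE //= -!(natr1 m.+1) -!(natr1 m) [(_ / 2) ^+ m.+2]exprS.
(* The identity already holds with the two powers and the index as independent variables, so it
   becomes one between rational functions. *)
move: ((r / 2) ^+ m.+1) (g ^+ m.+1) (m%:R) => a b n.
rewrite /C1 /C2 /C3 /I /II /D.
field.
by rewrite r0 D0.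
Qed.

(** * Integrals against the Pareto tail *)

Lemma integralN_lebesgue (R : realType) (D : set R) (f : R -> R) :
  measurable D -> measurable_fun setT f ->
  lebesgue_measure.-integrable (-%R @^-1` D) (fun x => (f (- x))%:E) ->
  (\int[lebesgue_measure]_(x in D) (f x)%:E =
   \int[lebesgue_measure]_(x in -%R @^-1` D) (f (- x))%:E)%E.
Proof.
move=> mD mf fi.
pose N : measurableTypeR R -> measurableTypeR R := -%R.
have mN : measurable_fun setT N by rewrite /N.
have -> : (\int[lebesgue_measure]_(x in D) (f x)%:E =
  \int[pushforward lebesgue_measure N]_(x in D) (f x)%:E)%E.
  apply: eq_measure_integral => A mA _.
  by symmetry; exact: lebesgue_measureN.
rewrite (@integral_pushforward _ _ (measurableTypeR R) (measurableTypeR R) R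
 N mN lebesgue_measure D (EFin \o f)) //.
by apply/measurable_EFinP.
Qed.

Section tail.
Variable R : realType.
Implicit Types (f g : R -> R) (M : R).

(** The function [u_s] of the overview, as a cast boolean so that products become conjunctions. *)
Definition ball_ind (s y : R) : R := (`|y| <= s)%R%:R.

Lemma ball_ind_ge0 s y : 0 <= ball_ind s y.
Proof. exact: ler0n. Qed.

Lemma ball_ind_le1 s y : ball_ind s y <= 1.
Proof. by rewrite /ball_ind lern1 leq_b1. Qed.

Lemma ball_ind_mono (s s' y : R) : s <= s' -> ball_ind s y <= ball_ind s' y.
Proof.
rewrite /ball_ind => ss; rewrite ler_nat.
by case: (leP `|y| s) => //= ys; rewrite (le_trans ys ss).
Qed.

Lemma ball_indN s y : ball_ind s (- y) = ball_ind s y.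
Proof. by rewrite /ball_ind normrN. Qed.

Lemma ball_indE s : ball_ind s = \1_(`[- s, s]%classic).
Proof.
by apply/funext => y; rewrite indicE mem_setE in_itv /= -ler_norml.
Qed.

Lemma measurable_ball_ind s : measurable_fun setT (ball_ind s).
Proof. by rewrite ball_indE; exact: measurable_indic. Qed.

(** A class stable under linear combinations and reflection, on which integrals against [nu] and
    against the Pareto tail are finite. *)
Definition cpt_bounded f :=
  measurable_fun setT f /\
  exists C s : R, [/\ 0 <= C, 0 <= s & forall y, `|f y| <= C * ball_ind s y].

Lemma cpt_boundedN f : cpt_bounded f -> cpt_bounded (fun y => f (- y)).
Proof.
move=> [mf [C [s [C0 s0 H]]]]; split.
  by apply: (measurableT_comp mf).
by exists C, s; split=> // y; rewrite (le_trans (H _)) ?ball_indN.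
Qed.

Lemma cpt_bounded_lin k f g : cpt_bounded f -> cpt_bounded g ->
  cpt_bounded (fun y => k * f y + g y).
Proof.
move=> [mf [C [s [C0 s0 H]]]] [mg [C' [s' [C'0 s'0 H']]]]; split.
  apply: measurable_funD => //; exact: measurable_funM.
exists (`|k| * C + C'), (s + s'); split; [|exact: addr_ge0|].
  by apply: addr_ge0 => //; apply: mulr_ge0.
move=> y; apply: (le_trans (ler_normD _ _)); rewrite mulrDl normrM -mulrA.
apply: lerD; first apply: ler_wpM2l => //.
  by apply: (le_trans (H _)); apply: ler_wpM2l => //; apply: ball_ind_mono; lra.
by apply: (le_trans (H' _)); apply: ler_wpM2l => //; apply: ball_ind_mono; lra.
Qed.

Lemma cpt_boundedM f g : cpt_bounded f -> measurable_fun setT g ->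
  (forall y, `|g y| <= 1) -> cpt_bounded (fun y => g y * f y).
Proof.
move=> [mf [C [s [C0 s0 H]]]] mg g1; split; first exact: measurable_funM.
exists C, s; split=> // y; rewrite normrM -[leRHS]mul1r.
by apply: ler_pM.
Qed.

Lemma cpt_bounded_ind s : 0 <= s -> cpt_bounded (ball_ind s).
Proof.
move=> s0; split; first exact: measurable_ball_ind.
by exists 1, s; split => // y; rewrite mul1r ger0_norm// ball_ind_ge0.
Qed.

Let mu := @lebesgue_measure R.

Lemma powRN_le1 (u r : R) : 1 <= u -> 0 <= r -> u `^ (- r) <= 1.
Proof.
move=> u1 r0; rewrite powRN invf_le1 ?powR_gt0 ?(lt_le_trans ltr01)//.
have <- : 1 `^ r = 1 :> R by rewrite powR1.
by rewrite ge0_ler_powR// nnegrE (le_trans ler01).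
Qed.

(** Bounded support replaces decay: the integrand vanishes beyond [s / M], and the power is at most
    1 on [[1, +oo[]. *)
Lemma integrable_tail f M k r : cpt_bounded f -> 0 < M -> 0 <= r ->
  mu.-integrable `[1, +oo[ (fun u => (f (M * u) * (k * `|u| `^ (- r)))%:E).
Proof.
move=> [mf [C [s [C0 s0 H]]]] M0 r0.
have mE : measurable (`[1, +oo[%classic : set R) by [].
apply: (@le_integrable _ _ _ mu `[1, +oo[ mE _
   (fun u => ((C * `|k|)%:E * (ball_ind (s / M) u)%:E)%E)).
- apply/measurable_EFinP/measurable_funTS; apply: measurable_funM.
    by apply: (measurableT_comp mf); apply: measurable_funM => //.
  apply: measurable_funM => //.
  by apply: (measurableT_comp (measurable_powR _)); exact: normr_measurable.
- move=> u /=; rewrite in_itv /= andbT => u1.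
  rewrite lee_fin [leRHS]ger0_norm ?mulr_ge0 ?ball_ind_ge0//.
  have u0 : 0 <= u by rewrite (le_trans ler01).
  rewrite normrM mulrAC; apply: ler_pM => //.
    apply: (le_trans (H _)); rewrite /ball_ind normrM (gtr0_norm M0).
    by rewrite ler_pdivlMr// [`|u| * M]mulrC.
  rewrite normrM [X in _ * X]ger0_norm ?powR_ge0// -[leRHS]mulr1.
  by apply: ler_wpM2l => //; rewrite ger0_norm//; exact: powRN_le1.
- apply: integrableZl => //; rewrite ball_indE.
  by apply: (@integrableS _ _ _ _ setT) => //; exact: integrable_indic_itv.
Qed.

Lemma integrable_tailN f M k r : cpt_bounded f -> 0 < M -> 0 <= r ->
  mu.-integrable `[1, +oo[ (fun u => (f (- (M * u)) * (k * `|u| `^ (- r)))%:E).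
Proof. by move=> /cpt_boundedN; exact: integrable_tail. Qed.

(** The reflection [u |-> - u] folds the negative half-line onto the positive one and turns the
    extended-real integral into a real one. *)
Lemma two_sided_tail f M k r : cpt_bounded f -> 0 < M -> 0 <= r ->
  (\int[mu]_(u in [set u : R | (1 <= `|u|)%R])
     ((f (M * u))%:E * (k * `|u| `^ (- r))%:E))%E =
  (\int[mu]_(u in `[1%R, +oo[)
     ((f (M * u) + f (- (M * u))) * (k * `|u| `^ (- r))))%:E.
Proof.
move=> ft M0 r0.
have -> : [set u : R | (1 <= `|u|)%R] = `[1, +oo[ `|` `]-oo, -1].
  apply/seteqP; split => u /=; rewrite !in_itv /= andbT ler_normr lerNr.
    by case/orP; [left|right].
  by case => ->; rewrite ?orbT.
pose phi u := f (M * u) * (k * `|u| `^ (- r)).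
have mphi : measurable_fun setT phi.
  case: ft => mf _.
  apply: measurable_funM.
    by apply: (measurableT_comp mf); apply: measurable_funM => //.
  apply: measurable_funM => //.
  by apply: (measurableT_comp (measurable_powR _)); exact: normr_measurable.
have i1 : mu.-integrable `[1, +oo[ (EFin \o phi) by exact: integrable_tail.
have i2 : mu.-integrable `[1, +oo[ (fun u => (phi (- u))%:E).
  apply: eq_integrable (integrable_tailN k ft M0 r0) => // u _ /=.
  by rewrite /phi normrN mulrN.
have pre : -%R @^-1` `]-oo, (- 1 : R)] = `[1, +oo[%classic.
  apply/seteqP; split => u /=; rewrite !in_itv /= ?andbT; lra.
under eq_integral do rewrite -EFinM.
rewrite integral_setU //; first last.
- rewrite disj_set2E; apply/eqP/seteqP; split => u //=.
  by rewrite !in_itv /= andbT => -[]; lra.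
- by apply/measurable_EFinP/measurable_funTS.
rewrite (@integralN_lebesgue _ `]-oo, (- 1)] phi) ?pre //.
rewrite -integralD_EFin //.
rewrite /Rintegral fineK; last first.
  by apply: integrable_fin_num => //; apply: eq_integrable (integrableD _ i1 i2)
   => // u _ /=; rewrite -EFinD /phi normrN mulrN mulrDl.
apply: eq_integral => u _ /=; rewrite -EFinD /phi normrN mulrN mulrDl //.
Qed.

(** The indicator cuts the integral at [s / M], and [- u ^ (- k)] is an antiderivative. Both
    [k = 2 * alpha] and [k = alpha] are needed later. *)
Lemma tail_ball k M s : 0 < k -> 0 < M -> 0 < s ->
  \int[mu]_(u in `[1%R, +oo[) (ball_ind s (M * u) * (k * `|u| `^ (- (k + 1)))) =
  ball_ind s M * (1 - (M / s) `^ k).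
Proof.
move=> k0 M0 s0.
have E u : ball_ind s (M * u) = ball_ind (s / M) u.
  by rewrite /ball_ind normrM (gtr0_norm M0) ler_pdivlMr// [`|u| * M]mulrC.
rewrite {2}/ball_ind gtr0_norm //; case: leP => Ms /=; last first.
  rewrite mul0r (@eq_Rintegral _ _ _ _ _ (cst 0)) ?Rintegral_cst ?mul0r //.
  move=> u /set_mem/=; rewrite in_itv/= andbT => u1.
  rewrite E /ball_ind leNgt (lt_le_trans (_ : s / M < 1)) ?mul0r //.
    by rewrite ltr_pdivrMr ?mul1r.
  by rewrite ger0_norm// (le_trans ler01).
have S1 : 1 <= s / M by rewrite ler_pdivlMr ?mul1r.
rewrite mul1r.
have -> : \int[mu]_(u in `[1%R, +oo[) (ball_ind s (M * u) * (k * `|u| `^ (- (k + 1))))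
  = \int[mu]_(u in `[1%R, s / M]) (k * u `^ (- (k + 1))).
  rewrite Rintegral_mkcond [RHS]Rintegral_mkcond; apply: eq_Rintegral => u _.
  rewrite !patchE !mem_setE !in_itv /= andbT E /ball_ind.
  case: ifP => //= u1; have u0 : 0 <= u by rewrite (le_trans ler01).
  by rewrite ger0_norm//; case: ifP => _; rewrite ?mul1r ?mul0r.
have -> : (M / s) `^ k = (s / M) `^ (- k).
  by rewrite -[M / s]invf_div -(@powR_inv1 _ (s / M)) ?divr_ge0 ?ltW// -powRrM mulN1r.
(* The fundamental theorem of calculus needs a nondegenerate interval, so [s / M = 1] is treated
   apart. *)
move: S1; rewrite le_eqVlt => /predU1P[<-|S1].
  by rewrite set_itv1 Rintegral_set1 powR1 subrr.
rewrite /Rintegral.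
rewrite (@continuous_FTC2 _ _ (fun u => - (u `^ (- k)))) //.
- by rewrite -EFinB /= powR1 opprK addrC.
- apply: derivable_within_continuous => x; rewrite in_itv /= => /andP[x1 _].
  have x0 : 0 < x by rewrite (lt_le_trans ltr01).
  apply: derivableM => //; apply: derivable_powR.
  by rewrite in_itv/= andbT.
- have der x : 0 < x -> derivable (fun u : R => - (u `^ (- k))) x 1.
    by move=> x0; apply: derivableN; apply: derivable_powR; rewrite in_itv/= andbT.
  have cts x : 0 < x -> {for x, continuous (fun u : R => - (u `^ (- k)))}.
    by move=> x0; apply/differentiable_continuous/derivable1_diffP/der.
  split.
  + by move=> x; rewrite in_itv /= => /andP[x1 _]; apply: der; rewrite (lt_trans ltr01).
  + by apply: cvg_at_right_filter; apply: cts.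
  + by apply: cvg_at_left_filter; apply: cts; rewrite (lt_trans ltr01).
- move=> x; rewrite in_itv /= => /andP[x1 _].
  have x0 : 0 < x by rewrite (lt_trans ltr01).
  rewrite derive1E deriveN; last by apply: derivable_powR; rewrite in_itv/= andbT.
  rewrite -derive1E powR_derive1 ?in_itv/= ?x0 //.
  by rewrite mulNr opprK opprD.
Qed.

End tail.

(** * The Kendall convolution of two symmetrised point masses *)

Section pair.
Variables (R : realType) (alpha : R).
Hypothesis alpha0 : 0 < alpha.
Implicit Types (f g : R -> R) (s x y z : R).

Let mu := @lebesgue_measure R.

(** Trading the positive part for a cut-off makes [v_s] polynomial in [u_s] and a power, so that
    later identities close by [ring]. *)
Lemma PsiE s y : 0 < s ->
  Psi alpha (y / s) = ball_ind s y * (1 - (`|y| / s) `^ alpha).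
Proof.
move=> s0; rewrite /Psi /ball_ind normrM normfV (gtr0_norm s0).
have ys0 : 0 <= `|y| / s by rewrite divr_ge0 // ltW.
have p1 : (1 : R) `^ alpha = 1 by rewrite powR1.
case: leP => ys /=.
  rewrite mul1r; apply/max_idPr; rewrite subr_ge0 -p1.
  by rewrite ge0_ler_powR ?nnegrE ?(ltW alpha0) // ler_pdivrMr ?mul1r.
rewrite mul0r; apply/max_idPl; rewrite subr_le0 -p1.
by rewrite ge0_ler_powR ?nnegrE ?(ltW alpha0) // ler_pdivlMr ?mul1r ?(ltW ys).
Qed.

Lemma PsiN y : Psi alpha (- y) = Psi alpha y.
Proof. by rewrite /Psi normrN. Qed.

Lemma Psi_ge0 y : 0 <= Psi alpha y.
Proof. by rewrite /Psi le_max lexx. Qed.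

Lemma measurable_Psi s : measurable_fun setT (fun y => Psi alpha (y / s)).
Proof.
rewrite /Psi; apply: measurable_maxr => //; apply: measurable_funB => //.
apply: (measurableT_comp (measurable_powR _)).
by apply: (measurableT_comp (@normr_measurable _ _)); apply: measurable_funM.
Qed.

Lemma cpt_bounded_Psi s : 0 < s -> cpt_bounded (fun y => Psi alpha (y / s)).
Proof.
move=> s0; split; first exact: measurable_Psi.
exists 1, s; split; rewrite ?(ltW s0)// => y.
rewrite ger0_norm ?Psi_ge0// PsiE// mul1r ler_piMr ?ball_ind_ge0//.
by rewrite gerBl powR_ge0.
Qed.

(** Real-valued form of [kendall_pair_int] with the two tails folded together; the two agree on
    [cpt_bounded] functions. *)
Definition kendall_pair_fun f x z : R :=
  let M := Num.max `|x| `|z| in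
  let m := Num.min `|x| `|z| in
  let rho := m / M in
  if M == 0 then f 0 else
  rho `^ alpha * \int[mu]_(u in `[1%R, +oo[)
      ((f (M * u) + f (- (M * u))) * (alpha * `|u| `^ (- (2 * alpha + 1))))
  + (1 - rho `^ alpha) / 2 * (f M + f (- M)).

Lemma max_norm_gt0 x z : Num.max `|x| `|z| != 0 -> 0 < Num.max `|x| `|z|.
Proof. by rewrite lt0r => ->; rewrite le_max normr_ge0. Qed.

Let e0 : 0 <= 2 * alpha + 1.
Proof. by have := alpha0; lra. Qed.

Lemma kendall_pair_intE f x z : cpt_bounded f ->
  kendall_pair_int alpha (EFin \o f) x z = (kendall_pair_fun f x z)%:E.
Proof.
move=> ft; rewrite /kendall_pair_int /kendall_pair_fun.
case: eqVneq => // M0; rewrite EFinD ![(_ * _)%:E]EFinM; congr (_ * _ + _)%E.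
by apply: two_sided_tail => //; exact: max_norm_gt0.
Qed.

Lemma kendall_pair_fun_lin k f g x z : cpt_bounded f -> cpt_bounded g ->
  kendall_pair_fun (fun y => k * f y + g y) x z =
  k * kendall_pair_fun f x z + kendall_pair_fun g x z.
Proof.
move=> ft gt; rewrite /kendall_pair_fun; case: ifPn => // /max_norm_gt0.
move: (Num.max _ _) => M M0.
set p := fun u : R => alpha * `|u| `^ (- (2 * alpha + 1)).
have I h : cpt_bounded h -> mu.-integrable `[1, +oo[
    (EFin \o (fun u : R => (h (M * u) + h (- (M * u))) * p u)).
  move=> ht; apply: eq_integrable (integrableD _
    (integrable_tail alpha ht M0 e0) (integrable_tailN alpha ht M0 e0)) => //.
  by move=> u _ /=; rewrite -EFinD -mulrDl.
have -> : \int[mu]_(u in `[1%R, +oo[) ((k * f (M * u) + g (M * u) +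
   (k * f (- (M * u)) + g (- (M * u)))) * p u) =
   k * \int[mu]_(u in `[1%R, +oo[) ((f (M * u) + f (- (M * u))) * p u) +
   \int[mu]_(u in `[1%R, +oo[) ((g (M * u) + g (- (M * u))) * p u).
  rewrite -RintegralZl ?I// -RintegralD ?I//.
    by apply: eq_Rintegral => u _; ring.
  by apply: (integrableZl _ k (I _ ft)).
by ring.
Qed.

(** The integrand enters only through [f y + f (- y)]; for [M = 0] the value [f 0] is half of this
    sum at 0. *)
Lemma eq_kendall_pair_fun f g x z : (forall y, f y + f (- y) = g y + g (- y)) ->
  kendall_pair_fun f x z = kendall_pair_fun g x z.
Proof.
move=> fg; rewrite /kendall_pair_fun; case: ifPn => _.
  by have := fg 0; rewrite oppr0; lra.
by rewrite fg; under eq_Rintegral do rewrite fg.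
Qed.

Lemma powR_double (b : R) : 0 <= b -> b `^ (2 * alpha) = (b `^ alpha) ^+ 2.
Proof.
move=> b0; rewrite mulrC powRrM -powR_mulrn ?powR_ge0//.
Qed.

(** With [w = (M/s)^alpha] and [M <= s], tail and atom give [rho^alpha (1 - w^2) + 1 - rho^alpha = 1
    - rho^alpha w^2], and [rho^alpha w = (m/s)^alpha]. *)
Lemma kendall_pair_fun_ind_minmax s x z : 0 < s ->
  let M := Num.max `|x| `|z| in let m := Num.min `|x| `|z| in
  kendall_pair_fun (ball_ind s) x z =
  ball_ind s M * (1 - (m / s) `^ alpha * (M / s) `^ alpha).
Proof.
move=> s0 M m; rewrite /kendall_pair_fun -/M -/m.
have m0 : 0 <= m by rewrite le_min !normr_ge0.
case: ifPn => [/eqP M0|/max_norm_gt0 M0].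
  by rewrite M0 mul0r powR0 ?gt_eqF// mulr0 subr0 mulr1.
rewrite -/M in M0.
rewrite ball_indN -mulr2n.
have -> : \int[mu]_(u in `[1%R, +oo[) ((ball_ind s (M * u) + ball_ind s (- (M * u)))
   * (alpha * `|u| `^ (- (2 * alpha + 1)))) = ball_ind s M * (1 - (M / s) `^ (2 * alpha)).
  rewrite -tail_ball ?mulr_gt0//; apply: eq_Rintegral => u _.
  by rewrite ball_indN; ring.
have Ms0 : 0 <= M / s by rewrite divr_ge0 ?ltW.
have -> : (m / s) `^ alpha = (m / M) `^ alpha * (M / s) `^ alpha.
  by rewrite -powRM ?divr_ge0 ?(ltW M0) ?(ltW s0)// mulrA divfK ?gt_eqF.
by rewrite powR_double//; field.
Qed.

(** With the same [w], the sum is [rho^alpha (1 - w)^2 + (1 - rho^alpha)(1 - w) = (1 - w)(1 -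
    rho^alpha w)]. *)
Lemma kendall_pair_fun_Psi_minmax s x z : 0 < s ->
  let M := Num.max `|x| `|z| in let m := Num.min `|x| `|z| in
  kendall_pair_fun (fun y => Psi alpha (y / s)) x z =
  ball_ind s M * (1 - (m / s) `^ alpha) * (1 - (M / s) `^ alpha).
Proof.
move=> s0 M m; rewrite /kendall_pair_fun -/M -/m.
have m0 : 0 <= m by rewrite le_min !normr_ge0.
case: ifPn => [/eqP M0|/max_norm_gt0 M0].
  have mM : m = 0 by apply/eqP; rewrite eq_le m0 -M0 ge_min le_max lexx.
  rewrite M0 mM !mul0r powR0 ?gt_eqF// subr0 !mulr1.
  by rewrite -[0](mul0r s^-1) PsiE// normr0 mul0r powR0 ?gt_eqF// subr0 mulr1.
rewrite -/M in M0.
rewrite mulNr PsiN -mulr2n.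
have Ms0 : 0 <= M / s by rewrite divr_ge0 ?ltW.
have -> : \int[mu]_(u in `[1%R, +oo[) ((Psi alpha (M * u / s) + Psi alpha (- (M * u) / s))
   * (alpha * `|u| `^ (- (2 * alpha + 1)))) = ball_ind s M * (1 - (M / s) `^ alpha) ^+ 2.
  (* Expanding [1 - w u^alpha] leaves two pure power tails, worth
     [(1 - w^2) - 2 w (1 - w) = (1 - w)^2]. *)
  transitivity (\int[mu]_(u in `[1%R, +oo[) (ball_ind s (M * u) *
       ((2 * alpha) * `|u| `^ (- (2 * alpha + 1))) -
     (2 * (M / s) `^ alpha) * (ball_ind s (M * u) * (alpha * `|u| `^ (- (alpha + 1)))))).
    apply: eq_Rintegral => u /set_mem/=; rewrite in_itv/= andbT => u1.
    have u0 : 0 < u by rewrite (lt_le_trans ltr01).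
    rewrite mulNr PsiN PsiE// normrM (gtr0_norm M0) mulrAC powRM//.
    have -> : `|u| `^ (- (alpha + 1)) = `|u| `^ alpha * `|u| `^ (- (2 * alpha + 1)).
      rewrite -powRD ?normr_eq0 ?(gt_eqF u0) ?implybT//; congr (_ `^ _); ring.
    by ring.
  have bt := cpt_bounded_ind (ltW s0).
  have a1 : 0 <= alpha + 1 by have := alpha0; lra.
  rewrite RintegralB//; last 2 first.
    exact: integrable_tail.
    by apply: (integrableZl _ (2 * (M / s) `^ alpha) (integrable_tail alpha bt M0 a1)).
  rewrite RintegralZl//; last exact: integrable_tail.
  rewrite !tail_ball ?mulr_gt0// powR_double//; ring.
have -> : (m / s) `^ alpha = (m / M) `^ alpha * (M / s) `^ alpha.
  by rewrite -powRM ?divr_ge0 ?(ltW M0) ?(ltW s0)// mulrA divfK ?gt_eqF.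
by rewrite PsiE// (gtr0_norm M0); field.
Qed.

Lemma ball_ind_max s x z :
  ball_ind s (Num.max `|x| `|z|) = ball_ind s x * ball_ind s z.
Proof.
rewrite /ball_ind ger0_norm ?le_max ?normr_ge0// ge_max -natrM mulnb //.
Qed.

(** Splitting [1 - b c = (1 - b) + b (1 - c)] separates the variables; integrating over [z] then
    yields [G u_s + H v_s], because [2 F - 1 = G + H]. *)
Lemma kendall_pair_fun_ind s x z : 0 < s ->
  kendall_pair_fun (ball_ind s) x z =
  Psi alpha (x / s) * ball_ind s z
  + (ball_ind s x - Psi alpha (x / s)) * Psi alpha (z / s).
Proof.
move=> s0; rewrite kendall_pair_fun_ind_minmax// ball_ind_max !PsiE//.
by case: (leP `|x| `|z|) => _; ring.
Qed.

(** Multiplicativity of the Williamson transform: the minimum and maximum formula is symmetric in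
    the two points. *)
Lemma kendall_pair_fun_Psi s x z : 0 < s ->
  kendall_pair_fun (fun y => Psi alpha (y / s)) x z =
  Psi alpha (x / s) * Psi alpha (z / s).
Proof.
move=> s0; rewrite kendall_pair_fun_Psi_minmax// ball_ind_max !PsiE//.
by case: (leP `|x| `|z|) => _; ring.
Qed.

End pair.

(** * The transition kernel for the step distribution *)

Section kernel.
Variables (R : realType) (alpha : R) (nu : probability R R).
Hypotheses (alpha0 : 0 < alpha) (nu_sym : symmetric_measure nu).
Implicit Types (f g : R -> R) (s x y z : R).

Lemma integrable_cpt_bounded f : cpt_bounded f ->
  nu.-integrable setT (EFin \o f).
Proof.
move=> [mf [C [s [C0 s0 H]]]]; apply: measurable_bounded_integrable => //.
  by rewrite (le_lt_trans (probability_le1 _ _)) ?ltry.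
exists C; split; first exact: num_real.
move=> r Cr y _ /=; apply: (le_trans (H y)); rewrite (le_trans _ (ltW Cr))//.
by rewrite ler_piMr ?ball_ind_le1.
Qed.

Lemma Rintegral_ball_ind s : 0 <= s ->
  \int[nu]_y ball_ind s y = 2 * kF nu s - 1.
Proof.
move=> s0; rewrite ball_indE /Rintegral integral_indic// setIT.
have mI : measurable (`]-oo, s]%classic : set R) by [].
have fI (A : set R) : measurable A -> nu A \is a fin_num.
  by move=> mA; exact: fin_num_measure.
have FE : kF nu s = fine (nu `]-oo, s]%classic).
  by rewrite /kF -set_itvNyc.
pose K : set R := `]-oo, (- s)[%classic.
have mK : measurable K by exact: measurable_itv.
(* By symmetry the mass below [- s] equals the mass above [s]. *)
have tail : nu K = (1 - nu `]-oo, s]%classic)%E.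
  rewrite nu_sym// -probability_setC//; congr (nu _).
  apply/seteqP; split => y; rewrite /K /=.
    by move=> [z + <-]; rewrite !in_itv/= => zs; apply/negP; rewrite -ltNge ltrNr.
  rewrite in_itv/= => /negP; rewrite -ltNge => ys.
  by exists (- y); rewrite ?opprK// in_itv/= ltrN2.
pose J : set R := `[- s, s]%classic.
have mJ : measurable J by exact: measurable_itv.
have split_ : nu `]-oo, s]%classic = (nu K + nu J)%E.
  rewrite -measureU//; last first.
    apply/seteqP; split => y //=; rewrite /J /K /= !in_itv/= => -[] + /andP[]; lra.
  congr (nu _); apply/seteqP; split => y /=; rewrite /J /K /= !in_itv/=.
    by move=> ys; case: (ltP y (- s)) => ?; [left|right].
  by case => [|/andP[]//]; lra.
have := fI _ mI; rewrite tail in split_; move: split_; rewrite FE.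
have := fI _ mJ; rewrite -/J.
case EJ: (nu J) => [u| |] // _; case: (nu `]-oo, s]%classic) => // v + _.
rewrite -EFinB -EFinD => -[] /= vE.
by transitivity u; [exact: (congr1 fine EJ)|lra].
Qed.

Lemma kG_ge0 s : 0 <= kG alpha nu s.
Proof. by apply: Rintegral_ge0 => y _; exact: Psi_ge0. Qed.

(** [Psi (y / s)] increases with [s]. Together with [kG_ge0] this excludes [G t = 0] in the theorem,
    whose formula divides by [G t]. *)
Lemma kG_mono s s' : 0 < s -> s <= s' -> kG alpha nu s <= kG alpha nu s'.
Proof.
move=> s0 ss; have s'0 := lt_le_trans s0 ss.
apply: le_Rintegral => //; try exact: (integrable_cpt_bounded (cpt_bounded_Psi alpha0 _)).
move=> y _; rewrite /Psi ge_max !le_max lexx /=; apply/orP; right.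
rewrite lerD2l lerN2 ge0_ler_powR ?nnegrE ?(ltW alpha0)// !normrM ler_wpM2l//.
by rewrite !normfV !gtr0_norm// lef_pV2.
Qed.

Lemma cpt_bounded0 : cpt_bounded (fun=> 0 : R).
Proof.
by split=> //; exists 0, 0; split => // y; rewrite normr0 mul0r.
Qed.

Lemma kendall_pair_fun0 x z : kendall_pair_fun alpha (fun=> 0) x z = 0.
Proof.
rewrite /kendall_pair_fun; case: ifP => // _.
under eq_Rintegral do rewrite addr0 mul0r.
by rewrite Rintegral_cst// !(mul0r, mulr0, addr0).
Qed.

Lemma Rintegral_lin k f g : cpt_bounded f -> cpt_bounded g ->
  \int[nu]_y (k * f y + g y) = k * \int[nu]_y f y + \int[nu]_y g y.
Proof.
move=> /integrable_cpt_bounded fi /integrable_cpt_bounded gi.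
rewrite -RintegralZl// -RintegralD//.
exact: (integrableZl _ k fi).
Qed.

(* Only the even part of the integrand matters because the kernel is symmetric. *)
Lemma kendall_kernel_intE f a t c d e h x : 0 < a -> 0 < t ->
  cpt_bounded f ->
  (forall y, f y + f (- y) = 2 * (c * ball_ind a y + d * Psi alpha (y / a)
                                + e * ball_ind t y + h * Psi alpha (y / t))) ->
  kendall_kernel_int alpha nu (EFin \o f) x =
  (c * kG alpha nu a * ball_ind a x
   + (c * kH alpha nu a + d * kG alpha nu a) * Psi alpha (x / a)
   + e * kG alpha nu t * ball_ind t x
   + (e * kH alpha nu t + h * kG alpha nu t) * Psi alpha (x / t))%:E.
Proof.
move=> a0 t0 ft fE; rewrite /kendall_kernel_int.
have ua := cpt_bounded_ind (ltW a0); have ut := cpt_bounded_ind (ltW t0).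
have va := cpt_bounded_Psi alpha0 a0; have vt := cpt_bounded_Psi alpha0 t0.
(* The nested shape ending in [+ 0] lets a rule for [k * f + g] peel off one basis function at a
   time. *)
pose comb (k : R * R * R * R) y := k.1.1.1 * ball_ind a y + (k.1.1.2 * Psi alpha (y / a)
   + (k.1.2 * ball_ind t y + (k.2 * Psi alpha (y / t) + 0))).
have c0 := cpt_bounded0.
have c1 k := cpt_bounded_lin k vt c0.
have c2 k k' := cpt_bounded_lin k' ut (c1 k).
have c3 k k' k'' := cpt_bounded_lin k'' va (c2 k k').
have cc k : cpt_bounded (comb k) by exact: cpt_bounded_lin.
(* For fixed [x] the pair integral is, in [z], again in the span; [k x] lists its coefficients. *)
pose k z := (c * Psi alpha (z / a),
   c * (ball_ind a z - Psi alpha (z / a)) + d * Psi alpha (z / a),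
   e * Psi alpha (z / t),
   e * (ball_ind t z - Psi alpha (z / t)) + h * Psi alpha (z / t)).
have E z : kendall_pair_fun alpha f x z = comb (k x) z.
  rewrite (@eq_kendall_pair_fun _ _ _ (comb (c, d, e, h))); last first.
    by move=> y; rewrite fE /comb /= !ball_indN !mulNr !PsiN; ring.
  rewrite /comb /= !kendall_pair_fun_lin// kendall_pair_fun0.
  by rewrite !kendall_pair_fun_ind// !kendall_pair_fun_Psi//; ring.
transitivity (\int[nu]_z (comb (k x) z))%:E.
  rewrite /Rintegral fineK; last first.
    by apply: integrable_fin_num => //; exact: (integrable_cpt_bounded (cc _)).
  by apply: eq_integral => z _; rewrite kendall_pair_intE// E.
rewrite /comb /= !Rintegral_lin// !Rintegral_ball_ind ?ltW//.
rewrite Rintegral_cst// mul0r -!/(kG alpha nu _) /kH; congr EFin; ring.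
Qed.

End kernel.

(** * Path probabilities of the walk killed above [a] *)

Section walk.
Variables (R : realType) (alpha : R) (nu : probability R R) (a t : R).
Hypotheses (alpha0 : 0 < alpha) (nu_sym : symmetric_measure nu).
Hypotheses (a0 : 0 < a) (a_lt_t : a < t).

Let t0 : 0 < t. Proof. exact: lt_trans a_lt_t. Qed.

Lemma indic_le_even y : \1_(`]-oo, a]%classic) y + \1_(`]-oo, a]%classic) (- y) =
  1 + ball_ind a y.
Proof.
have := a0; rewrite !indicE !mem_setE !in_itv /= /ball_ind ler_norml.
by case: (leP y a) => ya; case: (leP (- y) a) => ya'; case: (leP (- a) y) => ya'' /=; lra.
Qed.

Lemma indic_oc_even y : \1_(`]a, t]%classic) y + \1_(`]a, t]%classic) (- y) =
  ball_ind t y - ball_ind a y.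
Proof.
have := a0; have := a_lt_t; rewrite !indicE !mem_setE !in_itv /= /ball_ind !ler_norml.
by case: (leP y a) => ya; case: (leP (- y) a) => ya'; case: (leP (- a) y) => ya'';
 case: (leP y t) => yt; case: (leP (- y) t) => yt'; case: (leP (- t) y) => yt'' /=; lra.
Qed.

(** On [[-a, a]] one has [(|y|/t)^alpha = (a/t)^alpha (|y|/a)^alpha], so [v_t] is affine in [v_a]
    there. This keeps the span stable under killing. *)
Lemma ball_ind_Psi y : ball_ind a y * Psi alpha (y / t) =
  Psi alpha (a / t) * ball_ind a y + (1 - Psi alpha (a / t)) * Psi alpha (y / a).
Proof.
have ta : ball_ind t a = 1 by rewrite /ball_ind (gtr0_norm a0) (ltW a_lt_t).
rewrite !PsiE// ta (gtr0_norm a0).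
have -> : (`|y| / t) `^ alpha = (a / t) `^ alpha * (`|y| / a) `^ alpha.
  rewrite -powRM ?divr_ge0 ?(ltW a0) ?(ltW t0)//; congr (_ `^ _).
  by field; rewrite !gt_eqF.
rewrite [ball_ind a y]/ball_ind; case: leP => ya /=; last by ring.
rewrite /ball_ind (le_trans ya (ltW a_lt_t)) /=; ring.
Qed.

(** Induction on the number of steps spent below [a], conditioning on the first step; hence the
    arbitrary starting point [x]. *)
Lemma kendall_path_probE m x :
  let g := kG alpha nu a in let h := kH alpha nu a in
  let q := kG alpha nu t / 2 in let k := kH alpha nu t / 2 in
  let cd := passage_coef g h q k (Psi alpha (a / t)) m in
  kendall_path_prob alpha nu (nseq m `]-oo, a]%classic ++ [:: `]a, t]%classic]) x =
  (g * cd.1 * ball_ind a x + cd.2 * Psi alpha (x / a)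
   + q ^+ m.+1 * ball_ind t x + m.+1%:R * k * q ^+ m * Psi alpha (x / t))%:E.
Proof.
move=> g h q k; elim: m x => [|m IH] x cd.
  rewrite [LHS]/=.
  have -> : (fun y => (\1_(`]a, t]%classic) y)%:E * 1)%E =
      EFin \o (\1_(`]a, t]%classic : set R) : R -> R).
    by apply/funext => y; rewrite mule1.
  (* The even part of the indicator of []a, t]] is [(u_t - u_a) / 2]. *)
  rewrite (@kendall_kernel_intE _ _ _ alpha0 nu_sym _ a t (- 1 / 2) 0 (1 / 2) 0)//.
  - by congr EFin; rewrite /cd /= -/g -/h /q /k; field.
  - split; first exact: measurable_indic.
    exists 1, t; split => //; first exact: ltW.
    move=> y; rewrite mul1r ger0_norm ?indicE ?ler0n// ler_nat mem_setE in_itv/=.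
    case: (ltP a y) => //= ay; case: (leP y t) => //= yt.
    by rewrite gtr0_norm ?yt// (lt_trans a0 ay).
  - by move=> y; rewrite indic_oc_even; field.
rewrite [LHS]/=.
set cd' := passage_coef g h q k (Psi alpha (a / t)) m.
pose f y := g * cd'.1 * ball_ind a y + (cd'.2 * Psi alpha (y / a)
   + (q ^+ m.+1 * ball_ind t y + (m.+1%:R * k * q ^+ m * Psi alpha (y / t) + 0))).
have cf : cpt_bounded f.
  have ua := cpt_bounded_ind (ltW a0); have ut := cpt_bounded_ind (ltW t0).
  have va := cpt_bounded_Psi alpha0 a0; have vt := cpt_bounded_Psi alpha0 t0.
  by do 4 apply: cpt_bounded_lin => //; exact: cpt_bounded0.
have fN y : f (- y) = f y by rewrite /f !ball_indN !mulNr !PsiN.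
have -> : (fun y => (\1_(`]-oo, a]%classic) y)%:E *
     kendall_path_prob alpha nu (nseq m `]-oo, a]%classic ++ [:: `]a, t]%classic]) y)%E =
      EFin \o (fun y => \1_(`]-oo, a]%classic : set R) y * f y).
  by apply/funext => y; rewrite IH -EFinM /= /f -/cd' !addrA addr0.
set p := Psi alpha (a / t).
(* These are the coefficients of [(1 + u_a) f / 2], where [u_a u_t = u_a], [u_a v_a = v_a] and
   [u_a v_t = p u_a + (1 - p) v_a]. *)
rewrite (@kendall_kernel_intE _ _ _ alpha0 nu_sym _ a t
  (g * cd'.1 + (q ^+ m.+1 + m.+1%:R * k * q ^+ m * p) / 2)
  (cd'.2 + m.+1%:R * k * q ^+ m * (1 - p) / 2)
  (q ^+ m.+1 / 2) (m.+1%:R * k * q ^+ m / 2))//.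
- congr EFin; rewrite /cd /= -/cd' -/p -/g -/h.
  have -> : kG alpha nu t = 2 * q by rewrite /q; field.
  have -> : kH alpha nu t = 2 * k by rewrite /k; field.
  by rewrite -(natr1 m.+1) -(natr1 m) !exprS; field.
- apply: (@cpt_boundedM _ f \1_(`]-oo, a]%classic : set R)) => //.
  by move=> y; rewrite ger0_norm indicE ?ler0n// lern1 leq_b1.
- move=> y; rewrite fN -mulrDl indic_le_even.
  have B : ball_ind a y * ball_ind a y = ball_ind a y.
    by rewrite /ball_ind -natrM mulnb andbb.
  have B' : ball_ind a y * ball_ind t y = ball_ind a y.
    rewrite /ball_ind -natrM mulnb; congr (_%:R); case: (leP `|y| a) => //= ya.
    by rewrite (le_trans ya (ltW a_lt_t)).
  have B'' : ball_ind a y * Psi alpha (y / a) = Psi alpha (y / a).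
    by rewrite PsiE// mulrA B.
  rewrite mulrDl mul1r [in ball_ind a y * f y]/f 4!mulrDr mulr0.
  rewrite ![ball_ind a y * (_ * _)]mulrCA B B' B'' ball_ind_Psi -/p /f.
  by field.
Qed.

End walk.

(** * The first-passage event and the final formula *)

(** Makes the finite-dimensional distributions applicable. Entry [i] of the list constrains
    [X i.+1], since [X 0] is not recorded. *)
Lemma first_passage_cylinder (R : realType) (Omega : Type) (X : nat -> Omega -> R)
  (a t : R) (m : nat) :
  let As := nseq m `]-oo, a]%classic ++ [:: `]a, t]%classic] in
  [set w | first_passage_eq X a m.+1 w /\ X m.+1 w <= t] =
  [set w | forall i, (i < size As)%N -> nth setT As i (X i.+1 w)].
Proof.
move=> As; have sAs : size As = m.+1 by rewrite size_cat size_nseq addn1.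
apply/seteqP; split => w /=; rewrite sAs.
  move=> [[_ [aX H]] Xt] i; rewrite ltnS leq_eqVlt => /predU1P[->|im].
    by rewrite nth_cat size_nseq ltnn subnn /= in_itv/= aX.
  by rewrite nth_cat size_nseq im nth_nseq im /= in_itv/=; exact: H.
move=> H; have := H m (ltnSn m).
rewrite nth_cat size_nseq ltnn subnn /= in_itv/= => /andP[aX Xt].
split => //; split => //; split => // -[|k] // /andP[_]; rewrite ltnS => km.
have := H k (ltnW km); rewrite nth_cat size_nseq km nth_nseq km /= in_itv/=.
exact.
Qed.

Theorem mainTheorem13 (R : realType) (alpha : R) (nu : probability R R)
  (d : measure_display) (Omega : measurableType d) (P : probability Omega R)
  (X : nat -> Omega -> R) (a t : R) :
  0 < alpha ->
  symmetric_measure nu ->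
  nu [set 0] = 0%E ->
  is_kendall_random_walk alpha P nu X ->
  0 < a -> a < t ->
  nu [set a] = 0%E -> nu [set t] = 0%E ->
  kG alpha nu t != 2 * kG alpha nu a ->
  let F := kF nu in
  let G := kG alpha nu in
  let H := kH alpha nu in
  let D := 2 * G a - G t in
  let Phi n := P [set w | first_passage_eq X a n w /\ X n w <= t] in
  let II := (H a + H t + G a + G t) / 2 in
  let I := G t / 2 + H a * Psi alpha (a / t) / 2 + G a / 2 in
  let C1 := I - G a / D * (G a + H a * Psi alpha (a / t) * (1 - G t / D)) in
  let C2 := H a * Psi alpha (a / t) / D in
  let C3 := (H a * Psi alpha (a / t) + G a) / D
            - 2 * H a * G a * Psi alpha (a / t) / D ^+ 2 in
  Phi 1%N = (F t - F a)%:E /\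
  forall n : nat, (2 <= n)%N ->
    Phi n =
    ((G t / 2) ^+ n.-1 *
       (2 * G a * H a * (G t - G a) / D ^+ 2 - G a ^+ 2 / D
        + n.-1%:R * C1 * H t / G t
        - G a * H t / D * (C3 - C2 * G t / D)
        + II)
     + G a ^+ n.-1 *
       ((n%:R * H a + G a) * (G t - G a) / D
        - G a * G t * H a / D ^+ 2
        + G a * H t * C2 * n%:R / D
        + G t * H t / D * ((C3 - C2) / 2 - G a * C2 / D)
        + H t * (C3 - C2) / 2))%:E.
Proof.
move=> alpha0 nu_sym _ [_ [_ Xfdd]] a0 a_lt_t _ _ GtGa F G H D Phi II I C1 C2 C3.
have t0 := lt_trans a0 a_lt_t.
(* At the starting point 0 all basis functions equal 1, so the probability is the sum of the four
   coefficients. *)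
have at0 s : 0 < s -> ball_ind s 0 = 1 /\ Psi alpha (0 / s) = 1.
  move=> s0; rewrite mul0r /ball_ind /Psi normr0 (ltW s0) powR0 ?gt_eqF// subr0.
  by split=> //; apply/max_idPr.
have [[ua va] [ut vt]] := (at0 a a0, at0 t t0).
have PhiE m : let cd := passage_coef (G a) (H a) (G t / 2) (H t / 2)
      (Psi alpha (a / t)) m in
    Phi m.+1 = (G a * cd.1 + cd.2 + (G t / 2) ^+ m.+1
      + m.+1%:R * (H t / 2) * (G t / 2) ^+ m)%:E.
  move=> cd; rewrite /Phi first_passage_cylinder Xfdd.
    by rewrite kendall_path_probE// ua va ut vt !mulr1.
  move=> B; rewrite mem_cat mem_nseq inE => /orP[/andP[_]|] /eqP ->;
  exact: measurable_itv.
split.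
  (* The sum is [(G t + H t - G a - H a) / 2], and [G + H = 2 F - 1]. *)
  by rewrite PhiE /= !expr1 expr0 mulr1 /H /kH -/F -/G; congr EFin; field.
move=> [|[|m]] // _; rewrite PhiE /=.
rewrite passage_coef_sum//.
(* It remains to see [G t != 0]: otherwise [0 <= G a <= G t] forces [G a = 0], hence
   [G t = 2 * G a]. *)
have Ga0 : 0 <= G a := kG_ge0 _ _ _.
have GaGt : G a <= G t by apply: kG_mono => //; exact: ltW.
apply: contraNneq GtGa; rewrite -/G => Gt; rewrite Gt.
have -> : G a = 0 by apply/eqP; rewrite eq_le Ga0 -Gt GaGt.
by rewrite mulr0.
Qed.
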